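(* Let $D$ be a complete division ring of characteristic $0$ and let $m>0$ be an integer. Let $f:D\to D$ be a map having Gâteaux derivatives up to order $m$. Then for all $h_1,\dots,h_m\in D$ $$\partial^m(f(x)x)(h_1;\dots;h_m)=\partial^mf(x)(h_1;\dots;h_m)\,x+\sum_{i=1}^{m}\partial^{m-1}f(x)(h_1;\dots;\widehat{h_i};\dots;h_m)\,h_i,$$ where $\widehat{h_i}$ means that the variable $h_i$ is absent from the list.
   Context: A complete division ring of characteristic $0$ is a division ring $D$ of characteristic $0$ with an absolute value $|\cdot|:D\to\mathbb R$ ($|a|\ge0$, $|a|=0$ iff $a=0$, $|ab|=|a||b|$, $|a+b|\le|a|+|b|$), complete for the metric $|a-b|$, such that the embedding of the rational field $\mathbb Q$ (usual topology) into $D$ is a homeomorphism onto its image; then $\mathbb R$ is a subfield of the center $Z(D)$. A map $f:D\to D$ is differentiable in the Gâteaux sense if at every $x$ one has $f(x+a)-f(x)=\partial f(x)(a)+o(a)$, where $a\mapsto\partial f(x)(a)$ is linear (additive and homogeneous over $Z(D)$) and $o$ is a continuous map with $|o(a)|/|a|\to0$ as $a\to0$; then $\partial f(x)(a)=\lim_{t\to0,\,t\in\mathbb R}t^{-1}(f(x+ta)-f(x))$. Higher derivatives: $\partial^0f(x)=f(x)$ and $\partial^nf(x)(h_1;\dots;h_n)=\partial\big(\partial^{n-1}f(x)(h_1;\dots;h_{n-1})\big)(h_n)$, the outer $\partial$ being taken with respect to $x$. *)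

(* Defs.v *)
From HB Require Import structures.
From mathcomp Require Import all_boot all_order all_algebra.
From mathcomp Require Import all_classical all_reals all_analysis.

Set Implicit Arguments.
Unset Strict Implicit.
Unset Printing Implicit Defensive.

Import Order.TTheory GRing.Theory Num.Theory.
Import numFieldNormedType.Exports.

Local Open Scope classical_set_scope.
Local Open Scope ring_scope.

Definition homeomorphism_onto_image (S T : topologicalType) (f : S -> T) : Prop :=
  [/\ injective f,
      continuous f
    & forall A : set S, open A ->
        exists2 B : set T, open B & f @` A = range f `&` B].

(* The absolute value is not required to satisfy |n| = n on the integers (its
   restriction to the rationals may be a power of the usual one), so it need not
   be a norm in the sense of [normedZmodType], whence the separate structure. *)
HB.mixin Record isAbsValuedDivRing (R : realType) D & GRing.UnitRing D := {
  divring_unit : GRing.field_axiom D ;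
  absv : D -> R ;
  absv_ge0 : forall a, 0 <= absv a ;
  absv_eq0 : forall a, absv a = 0 <-> a = 0 ;
  absvM : forall a b, absv (a * b) = absv a * absv b ;
  ler_absvD : forall a b, absv (a + b) <= absv a + absv b
}.

#[short(type="absValuedDivRingType")]
HB.structure Definition AbsValuedDivRing (R : realType) :=
  { D of GRing.UnitRing D & isAbsValuedDivRing R D }.

Section AbsValueMetric.
Context {R : realType} {D : absValuedDivRingType R}.
Implicit Types a b c : D.

Lemma absv0 : absv (0 : D) = 0.
Proof. exact/absv_eq0. Qed.

Lemma absv1 : absv (1 : D) = 1.
Proof.
have n0 : absv (1 : D) != 0.
  by apply/eqP => /absv_eq0/eqP; rewrite oner_eq0.
by apply: (mulfI n0); rewrite -absvM !mulr1.
Qed.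

Lemma absvN a : absv (- a) = absv a.
Proof.
have N1 : absv (-1 : D) = 1.
  have /eqP : absv (-1 : D) ^+ 2 = 1.
    by rewrite expr2 -absvM mulrNN mulr1 absv1.
  rewrite sqrf_eq1 => /orP[/eqP//|/eqP h].
  by have := absv_ge0 (-1 : D); rewrite h ler0N1.
by rewrite -mulN1r absvM N1 mul1r.
Qed.

Definition absv_dist a b : R := absv (a - b).

Lemma absv_distxx a : absv_dist a a = 0.
Proof. by rewrite /absv_dist subrr absv0. Qed.

Lemma absv_dist_eq0 a b : absv_dist a b = 0 -> a = b.
Proof. by move=> /absv_eq0/eqP; rewrite subr_eq0 => /eqP. Qed.

Lemma absv_dist_sym a b : absv_dist a b = absv_dist b a.
Proof. by rewrite /absv_dist -absvN opprB. Qed.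

Lemma absv_dist_triangle b a c :
  absv_dist a c <= absv_dist a b + absv_dist b c.
Proof. by rewrite /absv_dist -(subrKA b) ler_absvD. Qed.

End AbsValueMetric.

HB.instance Definition _ (R : realType) (D : absValuedDivRingType R) :=
  isMetric.Build R (AbsValuedDivRing.sort D) (@absv_distxx R D)
    (@absv_dist_eq0 R D) (@absv_dist_sym R D) (@absv_dist_triangle R D).

Record complete_char0 (R : realType) (D : absValuedDivRingType R) : Prop := {
  complete_char0_pchar : [pchar D] =i pred0 ;
  (* the axiom of [completeType], which cannot be used directly because it also
     requires a distinguished point *)
  complete_char0_cauchy_cvg : forall F : set_system D,
    ProperFilter F -> cauchy F -> exists l : D, F --> l ;
  (* [rat^o] carries the topology of the usual absolute value on [rat] *)
  complete_char0_ratr : homeomorphism_onto_image (ratr : rat^o -> D)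
}.

Section Gateaux.
Context {R : realType} {D : absValuedDivRingType R}.
Implicit Types (f L o : D -> D) (x a h z : D) (hs : seq D) (m : nat).

Definition central z : Prop := forall y : D, GRing.comm z y.

Definition center_linear L : Prop :=
  {morph L : a b / a + b} /\ forall z a, central z -> L (z * a) = z * L a.

Definition is_gateaux_derivative f x L : Prop :=
  center_linear L /\
  exists o, [/\ forall a, f (x + a) - f x = L a + o a,
                continuous o
              & absv (o a) / absv a @[a --> (0 : D)^'] --> (0 : R)].

Definition gateaux_differentiable f : Prop :=
  forall x, exists L, is_gateaux_derivative f x L.

(* Over a ring satisfying [complete_char0] the derivative is unique when it
   exists; [gateaux f x] is the zero map when it does not. *)
Definition gateaux f x : D -> D :=
  xget (fun=> 0) [set L | is_gateaux_derivative f x L].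

Definition gateauxn f hs : D -> D :=
  foldl (fun g h x => gateaux g x h) f hs.

Lemma gateauxn0 f x : gateauxn f [::] x = f x.
Proof. by []. Qed.

Lemma gateauxn_rcons f hs h x :
  gateauxn f (rcons hs h) x = gateaux (gateauxn f hs) x h.
Proof. by rewrite /gateauxn foldl_rcons. Qed.

Definition gateaux_differentiable_upto m f : Prop :=
  forall hs, (size hs < m)%N -> gateaux_differentiable (gateauxn f hs).

End Gateaux.

(* Main.v *)
From HB Require Import structures.
Require Import Defs.
From mathcomp Require Import all_boot all_order all_algebra.
From mathcomp Require Import all_classical all_reals all_analysis.
From mathcomp Require Import complex ring lra zify.

(** Formally the statement is the Leibniz rule for the product of [f] and the
    identity, applied [m] times. The analytic content is in the first
    application: if [f (x + a) - f x = L a + o a], then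
<<
      f (x + a) * (x + a) - f x * x
        = (L a * x + f x * a) + (L a * a + o a * (x + a)),
>>
    and the second bracket is a legitimate remainder, continuous and negligible
    with respect to [a], only if the linear map [L] is continuous. Linearity
    over the center does not give this by itself; it holds because a complete
    division ring of characteristic 0 is the real line, the complex plane or
    the quaternions, so that every map linear over the center is continuous
    ([center_linear_continuous]).

    The classification itself can be bypassed. The reals embed centrally in [D]
    as the closure of the rationals ([real_embedding]). Ostrowski's theorem
    gives, for every [x], real numbers [a] and [c >= 0] with
    [(x - a) ^+ 2 + c = 0] ([quad_root]). When [D] is commutative,
    [L y = y * L 1]. Otherwise the quadratic equations produce anticommuting
    square roots [i], [j] of -1 whose common centralizer is central
    ([quaternion_units], [comm_quaternion_central]). Averaging [y] over
    conjugations by [i] and [j] then writes [4 y] as a combination of fixed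
    elements whose central coefficients depend continuously on [y]
    ([quaternion_coordinates]), and a center-linear map is a combination of
    these coefficients.

    With continuity at hand, derivatives are unique and satisfy the sum and
    product rules, and the formula follows by induction on the list of
    directions: differentiating the expression [leibniz f hs] in the direction
    [h] gives [leibniz f (rcons hs h)] ([is_gateaux_derivative_leibniz]). *)

Set Implicit Arguments.
Unset Strict Implicit.
Unset Printing Implicit Defensive.

Import Order.TTheory GRing.Theory Num.Theory.
Import numFieldNormedType.Exports.

Local Open Scope ring_scope.

(** * Limits in a division ring with an absolute value *)

Section Topology.
Local Open Scope classical_set_scope.
Context {R : realType} {D : absValuedDivRingType R}.
Implicit Types (a b : D).

Lemma absvB a b : absv (a - b) = absv (b - a).
Proof. exact: absv_dist_sym. Qed.

Lemma absv_gt0 a : (0 < absv a) = (a != 0).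
Proof.
rewrite lt_neqAle absv_ge0 andbT eq_sym; congr (~~ _).
by apply/eqP/eqP => /absv_eq0.
Qed.

Lemma neq0_divring_unit a : a != 0 -> a \is a GRing.unit.
Proof. exact: divring_unit. Qed.

Lemma divring_mulf_eq0 a b : a * b = 0 -> a = 0 \/ b = 0.
Proof.
move=> /absv_eq0; rewrite absvM => /eqP; rewrite mulf_eq0.
by case/orP => /eqP/absv_eq0; [left|right].
Qed.

Lemma absvX a n : absv (a ^+ n) = absv a ^+ n.
Proof. by elim: n => [|n IH]; rewrite ?absv1// !exprS absvM IH. Qed.

Lemma absvV a : absv a^-1 = (absv a)^-1.
Proof.
have [->|a0] := eqVneq a 0; first by rewrite invr0 absv0 invr0.
apply: (@mulfI _ (absv a)); first by rewrite gt_eqF// absv_gt0.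
by rewrite -absvM !divrr ?absv1 ?unitfE ?gt_eqF ?absv_gt0// neq0_divring_unit.
Qed.

Lemma ler_absv_sub a b : absv a - absv b <= absv (a - b).
Proof. by rewrite lerBlDr -{1}(subrK b a) ler_absvD. Qed.

Lemma ler_dist_absv a b : `|absv a - absv b| <= absv (a - b).
Proof.
by rewrite ler_norml ler_absv_sub andbT lerNl opprB absvB ler_absv_sub.
Qed.

Section Filters.
Context {T : Type} {F : set_system T} {FF : Filter F}.
Implicit Types (f g : T -> D) (l : D).

(** Limits in the division ring are reduced to limits of real functions, so
    that the arithmetic of limits follows by squeezing. *)
Lemma absv_cvgP f l :
  f x @[x --> F] --> l <-> absv (f x - l) @[x --> F] --> (0 : R).
Proof.
split=> [fl|fl].
- apply/cvgrPdist_lt => e e0; near=> x.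
  rewrite sub0r normrN ger0_norm ?absv_ge0// absvB.
  by near: x; have /cvg_ballP/(_ e e0) := fl; apply.
- apply/cvg_ballP => e e0; near=> x.
  suff : `|0 - absv (f x - l)| < e.
    by rewrite sub0r normrN ger0_norm ?absv_ge0// absvB.
  by near: x; move/cvgrPdist_lt: fl; apply.
Unshelve. all: by end_near. Qed.

Lemma absv_cvg_squeeze f l (u : T -> R) :
  (forall x, absv (f x - l) <= u x) -> u x @[x --> F] --> (0 : R) ->
  f x @[x --> F] --> l.
Proof.
move=> fu u0; apply/absv_cvgP.
apply: (squeeze_cvgr (f := fun=> 0) (h := u)) => //; last exact: cvg_cst.
by near=> x; rewrite absv_ge0 fu.
Unshelve. all: by end_near. Qed.

Lemma absv_cvg f l : f x @[x --> F] --> l -> absv (f x) @[x --> F] --> absv l.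
Proof.
move=> /absv_cvgP fl; apply/cvgrPdist_lt => e e0; near=> x.
rewrite distrC (le_lt_trans (ler_dist_absv _ _))//.
rewrite -[ltLHS]ger0_norm ?absv_ge0// -normrN -sub0r.
by near: x; move/cvgrPdist_lt: fl; apply.
Unshelve. all: by end_near. Qed.

Lemma absv_cvgD f g l m : f x @[x --> F] --> l -> g x @[x --> F] --> m ->
  f x + g x @[x --> F] --> l + m.
Proof.
move=> /absv_cvgP fl /absv_cvgP gm.
apply: (@absv_cvg_squeeze _ _ (fun x => absv (f x - l) + absv (g x - m))).
- by move=> x; rewrite opprD addrACA ler_absvD.
- by rewrite -[0 in X in _ --> X]addr0; exact: cvgD.
Qed.

Lemma absv_cvgM f g l m : f x @[x --> F] --> l -> g x @[x --> F] --> m ->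
  f x * g x @[x --> F] --> l * m.
Proof.
move=> fl gm; have g'm := absv_cvg gm.
move/absv_cvgP : fl => fl; move/absv_cvgP : gm => gm.
apply: (@absv_cvg_squeeze _ _
  (fun x => absv (f x - l) * absv (g x) + absv l * absv (g x - m))).
- move=> x; rewrite -!absvM.
  by rewrite (le_trans _ (ler_absvD _ _))// mulrBl mulrBr subrKA.
- have -> : 0 = 0 * absv m + absv l * 0 :> R by rewrite mul0r mulr0 addr0.
  by apply: cvgD; [exact: cvgM|exact: cvgM (cvg_cst _) gm].
Qed.

Lemma absv_cvgMl a f l : f t @[t --> F] --> l -> a * f t @[t --> F] --> a * l.
Proof. exact: (absv_cvgM (f := fun=> a) (cvg_cst a)). Qed.

Lemma absv_cvgMr a f l : f t @[t --> F] --> l -> f t * a @[t --> F] --> l * a.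
Proof. by move=> fl; apply: (absv_cvgM fl (g := fun=> a)); exact: cvg_cst. Qed.

Lemma absv_cvgN f l : f x @[x --> F] --> l -> - f x @[x --> F] --> - l.
Proof.
move=> fl; rewrite -[- l]mulN1r.
under eq_fun do rewrite -[- _]mulN1r.
exact: absv_cvgMl.
Qed.

Lemma absv_cvgB f g l m : f x @[x --> F] --> l -> g x @[x --> F] --> m ->
  f x - g x @[x --> F] --> l - m.
Proof. by move=> fl gm; apply: absv_cvgD => //; exact: absv_cvgN. Qed.

End Filters.

Lemma absv_cvg_unique {T} {F : set_system T} {FF : ProperFilter F}
    (f : T -> D) (l m : D) :
  f x @[x --> F] --> l -> f x @[x --> F] --> m -> l = m.
Proof.
move=> fl fm.
have : f t - f t @[t --> F] --> l - m by exact: absv_cvgB.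
under eq_fun do rewrite subrr.
move=> /absv_cvg; rewrite absv0 => c; apply/eqP; rewrite -subr_eq0; apply/eqP.
by apply/absv_eq0; apply: cvg_unique c _ => //; exact: cvg_cst.
Qed.

End Topology.

(** * The central copy of the real line *)

Section Reals.
Local Open Scope classical_set_scope.
Context {R : realType} {D : absValuedDivRingType R}.
Hypothesis D_complete : complete_char0 D.

Lemma complete_ratr_inj : injective (ratr : rat -> D).
Proof. by have [] := complete_char0_ratr D_complete. Qed.

Lemma intr_divring_unit (z : int) : z != 0 -> (z%:~R : D) \is a GRing.unit.
Proof.
move=> z0; apply: divring_unit; apply: contra z0 => /eqP z0.
suff : (z%:~R : rat) = 0 by move/eqP; rewrite intr_eq0.
by apply: complete_ratr_inj; rewrite (ratr_nat _ 0) ratr_int z0.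
Qed.

Lemma comm_ratr (y : D) (q : rat) : GRing.comm y (ratr q).
Proof.
apply: commrM; first exact: commr_int.
by apply: commrV; exact: commr_int.
Qed.

(** [ratr] is an additive and multiplicative map only when nonzero integers are
    invertible. Both facts come from the following criterion, which computes
    [ratr q] from any fraction representing [q], reduced or not. *)
Lemma ratr_mul_den (q : rat) (d n : int) :
  q * d%:~R = n%:~R -> ratr q * d%:~R = n%:~R :> D.
Proof.
move=> qd; have /(congr1 (fun z : int => z%:~R : D)) : numq q * d = n * denq q.
  apply: (@intr_inj rat); rewrite !rmorphM/= -qd mulrAC; congr (_ * _).
  by rewrite -{2}(divq_num_den q) divfK// intr_eq0 denq_eq0.
rewrite !rmorphM/= => e; rewrite /ratr -mulrA.
rewrite -(commrV (commr_int _ _)).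
by rewrite mulrA e mulrK// intr_divring_unit// denq_eq0.
Qed.

Lemma ratr_den (q : rat) : ratr q * (denq q)%:~R = (numq q)%:~R :> D.
Proof.
by apply: ratr_mul_den; rewrite -{1}(divq_num_den q) divfK// intr_eq0 denq_eq0.
Qed.

Lemma numq_den (q : rat) : (numq q)%:~R = q * (denq q)%:~R.
Proof. by rewrite -{2}(divq_num_den q) divfK// intr_eq0 denq_eq0. Qed.

Lemma ratr_divringB (p q : rat) : ratr (p - q) = ratr p - ratr q :> D.
Proof.
have u : ((denq p * denq q)%:~R : D) \is a GRing.unit.
  by rewrite intr_divring_unit// mulf_neq0// denq_eq0.
apply: (mulIr u).
rewrite (@ratr_mul_den _ _ (numq p * denq q - numq q * denq p)); last first.
  rewrite rmorphB !rmorphM/= !numq_den mulrBl !mulrA; congr (_ - _).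
  by rewrite mulrAC.
rewrite mulrBl [in RHS]rmorphM/= mulrA ratr_den.
rewrite (commr_int (denq p)%:~R (denq q)).
by rewrite mulrA ratr_den rmorphB !rmorphM.
Qed.

Lemma ratr_divringM (p q : rat) : ratr (p * q) = ratr p * ratr q :> D.
Proof.
have u : ((denq p * denq q)%:~R : D) \is a GRing.unit.
  by rewrite intr_divring_unit// mulf_neq0// denq_eq0.
apply: (mulIr u).
rewrite (@ratr_mul_den _ _ (numq p * numq q)); last first.
  by rewrite !rmorphM/= !numq_den mulrACA.
by rewrite [in RHS]rmorphM/= mulrA -(mulrA (ratr p))
  -(comm_ratr (denq p)%:~R q) mulrA ratr_den -mulrA ratr_den rmorphM.
Qed.

Lemma ratr_small (e : R) : 0 < e ->
  exists2 d : R, 0 < d &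
    forall q : rat, `|ratr q : R| < d -> absv (ratr q : D) < e.
Proof.
move=> e0; have [_ /(_ 0) c _] := complete_char0_ratr D_complete.
have /cvg_ballP/(_ e e0)/nbhs_ballP[/= d d0 dP] := c.
exists (ratr d); first by rewrite ltr0q.
move=> q; rewrite -ratr_norm ltr_rat => qd.
have := dP q; rewrite /ball/= sub0r normrN => /(_ qd).
by rewrite (ratr_nat _ 0) /absv_dist sub0r absvN.
Qed.

(** The inverse of the embedding of the rationals is continuous at 0. This half
    of the homeomorphism makes the absolute value monotone on the reals
    ([absv_real_le]). *)
Lemma ratr_bounded : exists2 d : R, 0 < d &
  forall q : rat, absv (ratr q : D) < d -> `|ratr q : R| <= 1.
Proof.
have [_ _ /(_ (ball (0 : rat^o) 1))] := complete_char0_ratr D_complete.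
case=> [|B oB BE]; first exact: ball_open.
have [_ B0] : (range (ratr : rat -> D) `&` B) (ratr 0).
  by rewrite -BE; exists 0 => //; exact: ballxx.
have /nbhs_ballP[d /= d0 dB] : nbhs (ratr 0 : D) B by exact: open_nbhs_nbhs.
exists d => // q qd.
have : (range (ratr : rat -> D) `&` B) (ratr q).
  split; first by exists q.
  apply: dB; rewrite /ball/= /absv_dist (ratr_nat _ 0) sub0r.
  by rewrite absvN.
rewrite -BE => -[q' /= q'1 /complete_ratr_inj <-].
move: q'1; rewrite /ball/= sub0r normrN => /ltW.
by rewrite -(@ler_rat R) ratr_norm (ratr_nat _ 1).
Qed.

Lemma ratr_dense (r : R) : exists u : nat -> rat,
  (ratr (u n) : R) @[n --> \oo] --> r.
Proof.
have /choice[u uP] (n : nat) : exists q : rat, r < ratr q < r + n.+1%:R^-1.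
  have : r < r + n.+1%:R^-1 by rewrite ltrDl invr_gt0.
  by move=> /rat_in_itvoo[q]; rewrite in_itv/=; exists q.
exists u; apply: (squeeze_cvgr (f := fun=> r) (h := fun n => r + n.+1%:R^-1)).
- by near=> n; have /andP[/ltW -> /ltW ->] := uP n.
- exact: cvg_cst.
- rewrite -[X in _ --> X]addr0; apply: cvgD; first exact: cvg_cst.
  exact: cvg_harmonic.
Unshelve. all: by end_near. Qed.

Lemma ratr_cvg0 (u : nat -> rat) : (ratr (u n) : R) @[n --> \oo] --> (0 : R) ->
  (ratr (u n) : D) @[n --> \oo] --> (0 : D).
Proof.
move=> u0; apply/cvg_ballP => e e0; have [d d0 dP] := ratr_small e0.
near=> n; rewrite /ball/= /absv_dist sub0r absvN; apply: dP.
by near: n; exact: cvgr0_norm_lt.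
Unshelve. all: by end_near. Qed.

(** An additive map continuous at 0 sends Cauchy sequences to Cauchy sequences,
    and sequences with the same limit to sequences with the same limit; so the
    limit in [D] exists and depends only on the limit [r]. *)
Lemma ratr_cvg_ex (r : R) : exists x : D, forall u : nat -> rat,
  (ratr (u n) : R) @[n --> \oo] --> r -> (ratr (u n) : D) @[n --> \oo] --> x.
Proof.
have [u ur] := ratr_dense r.
have [] := complete_char0_cauchy_cvg D_complete
  (F := (ratr (u n) : D) @[n --> \oo]).
  apply/cauchy_ballP => e e0; have [d d0 dP] := ratr_small e0.
  rewrite near_map2; near=> n m; rewrite /ball/= /absv_dist -ratr_divringB.
  apply: dP; rewrite rmorphB/= -(subrKA r) (le_lt_trans (ler_normD _ _))//.
  rewrite (splitr d) ltrD//; last first.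
    by near: m; apply: cvgr_dist_lt => //; exact: divr_gt0.
  rewrite distrC.
  by near: n; apply: cvgr_dist_lt => //; exact: divr_gt0.
move=> x ux; exists x => v vr.
have vu0 : (ratr (v n - u n) : D) @[n --> \oo] --> (0 : D).
  apply: ratr_cvg0; under eq_fun do rewrite rmorphB; rewrite -(subrr r).
  exact: cvgB.
rewrite -[x]add0r.
have -> : (fun n => ratr (v n) : D) = (fun n => ratr (v n - u n) + ratr (u n)).
  by apply/funext => n; rewrite ratr_divringB subrK.
exact: absv_cvgD.
Unshelve. all: by end_near. Qed.

(** The image of the rationals is uniformly continuous and additive, hence
    extends by completeness to the real line; centrality, continuity and the
    control of small elements pass to the limit. *)
Lemma real_embedding : exists phi : {rmorphism R -> D},
  [/\ forall t, central (phi t),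
      forall e, 0 < e -> exists2 d, 0 < d &
        forall t, `|t| < d -> absv (phi t) <= e
    & exists2 d, 0 < d & forall t, absv (phi t) < d -> `|t| <= 1].
Proof.
have /choice[phi phiP] := ratr_cvg_ex.
have phiE (r : R) (x : D) (u : nat -> rat) :
    (ratr (u n) : R) @[n --> \oo] --> r ->
    (ratr (u n) : D) @[n --> \oo] --> x -> phi r = x.
  by move=> ur; apply: absv_cvg_unique; exact: phiP.
have phiB : zmod_morphism phi.
  move=> r s; have [u ur] := ratr_dense r; have [v vs] := ratr_dense s.
  apply: (phiE _ _ (fun n => u n - v n)).
    by under eq_fun do rewrite rmorphB; exact: cvgB.
  under eq_fun do rewrite ratr_divringB.
  by apply: absv_cvgB; exact: phiP.
have phiM : monoid_morphism phi.
  split=> [|r s].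
    apply: (phiE _ _ (fun=> 1)); first by rewrite rmorph1; exact: cvg_cst.
    by rewrite (ratr_nat _ 1); exact: cvg_cst.
  have [u ur] := ratr_dense r; have [v vs] := ratr_dense s.
  apply: (phiE _ _ (fun n => u n * v n)).
    by under eq_fun do rewrite rmorphM; exact: cvgM.
  under eq_fun do rewrite ratr_divringM.
  by apply: absv_cvgM; exact: phiP.
pose phiA := GRing.isZmodMorphism.Build _ _ phi phiB.
pose phiMM := GRing.isMonoidMorphism.Build _ _ phi phiM.
pose Phi : {rmorphism R -> D} := HB.pack phi phiA phiMM.
exists Phi; split=> [t y|e e0|].
- have [u ut] := ratr_dense t.
  apply: (absv_cvg_unique (F := \oo) (f := fun n => ratr (u n) * y)).
    by apply: absv_cvgM; [exact: phiP|exact: cvg_cst].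
  under eq_fun do rewrite -comm_ratr.
  by apply: absv_cvgM; [exact: cvg_cst|exact: phiP].
- have [d d0 dP] := ratr_small e0; exists d => // t td.
  have [u ut] := ratr_dense t.
  apply: (cvgr_to_le (absv_cvg (phiP _ _ ut))).
  near=> n; apply/ltW/dP.
  by near: n; exact: (cvgr_norm_lt _ ut).
- have [d d0 dP] := ratr_bounded; exists d => // t td.
  have [u ut] := ratr_dense t.
  apply: (cvgr_to_le (cvg_norm ut)).
  near=> n; apply/dP; rewrite -[ltLHS]ger0_norm ?absv_ge0//.
  near: n; apply: cvgr_norm_lt; first exact: absv_cvg (phiP _ _ ut).
  by rewrite ger0_norm ?absv_ge0.
Unshelve. all: by end_near. Qed.

End Reals.

(** * Ostrowski's theorem: every element is quadratic over the reals *)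

(** Over the complex numbers [P] splits, and being real it equals its conjugate;
    the product of the two factorizations pairs each root [z] with its
    conjugate, and the factor of such a pair is
    [('X - Re z) ^+ 2 + (Im z) ^+ 2]. Taking the square avoids separating the
    real roots, which occur with arbitrary multiplicity, from the others. *)
Lemma monic_sqr_prod (R : realType) (P : {poly R}) : P \is monic ->
  exists2 r : seq (R * R), size r = (size P).-1 &
    P ^+ 2 = \prod_(p <- r) (('X - p.1%:P) ^+ 2 + (p.2 ^+ 2)%:P).
Proof.
move=> Pm; pose PC := map_poly (real_complex R) P.
have [r PCr] := closed_field_poly_normal PC.
have PCm : lead_coef PC = 1 by rewrite lead_coef_map (monicP Pm).
rewrite PCm scale1r in PCr.
have PCconj : map_poly (@conjc R) PC = PC.
  rewrite /PC -map_poly_comp; apply: eq_map_poly => t /=.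
  by rewrite /conjc oppr0.
exists [seq (complex.Re z, complex.Im z) | z <- r].
  by rewrite size_map -(size_map_poly (real_complex R)) -/PC PCr
     size_prod_XsubC.
apply: (@map_inj_poly _ _ (real_complex R)); [by move=> ? ? []|by []|].
rewrite rmorphXn/= -/PC expr2 -{1}PCconj PCr.
rewrite rmorph_prod big_map rmorph_prod /= -big_split/=.
apply: eq_bigr => -[a b] _ /=.
rewrite !(rmorphB, rmorphD, rmorphXn)/= !map_polyX !map_polyC/=.
have -> : (a -i* b)%C = a%:C%C - (0 +i* b)%C.
  by apply/eqP; rewrite eq_complex /= subr0 sub0r !eqxx.
have -> : (a +i* b)%C = a%:C%C + (0 +i* b)%C.
  by apply/eqP; rewrite eq_complex /= addr0 add0r !eqxx.
have -> : (b%:C%C)%:P ^+ 2 = - ((0 +i* b)%C)%:P ^+ 2 :> {poly R[i]}.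
  rewrite -!rmorphXn -rmorphN/=; congr (_%:P); rewrite !expr2; apply/eqP.
  by rewrite eq_complex /= !(mul0r, mulr0, subr0, addr0, sub0r, opprK, oppr0)
    !eqxx.
rewrite rmorphB rmorphD/=; ring.
Qed.

Section Ostrowski.
Local Open Scope classical_set_scope.
Context {R : realType} {D : absValuedDivRingType R} (phi : {rmorphism R -> D}).
Hypothesis phi_central : forall t, central (phi t).
Hypothesis phi_small : forall e, 0 < e ->
  exists2 d, 0 < d & forall t, `|t| < d -> absv (phi t) <= e.
Hypothesis phi_bounded :
  exists2 d, 0 < d & forall t, absv (phi t) < d -> `|t| <= 1.

Lemma phi_cvg (r : R) : phi t @[t --> r] --> phi r.
Proof.
apply/cvg_ballP => e e0.
have [d d0 dP] := phi_small (divr_gt0 e0 (@ltr0n R 2)).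
near=> t; rewrite /ball/= /absv_dist -rmorphB.
apply: (@le_lt_trans _ _ (e / 2)); last by lra.
by apply: dP; near: t; exact: cvgr_dist_lt.
Unshelve. all: by end_near. Qed.

Lemma absv_real_gt0 t : t != 0 -> 0 < absv (phi t).
Proof. by move=> t0; rewrite absv_gt0 fmorph_eq0. Qed.

(** If [1 < |t|] but [absv (phi t) < 1], the powers of [t] stay away from 0 in
    the reals while their images tend to 0, against [phi_bounded]. *)
Lemma absv_real_ge1 t : 1 <= `|t| -> 1 <= absv (phi t).
Proof.
rewrite le_eqVlt => /orP[/eqP t1|t1].
  have [->|->] : t = 1 \/ t = -1 by case: (ger0P t) t1; [left|right]; lra.
    by rewrite rmorph1 absv1.
  by rewrite rmorphN1 absvN absv1.
rewrite leNgt; apply/negP => wt1; have [d d0 dP] := phi_bounded.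
have w0 : absv (phi t) ^+ n @[n --> \oo] --> (0 : R).
  by apply: cvg_expr; rewrite ger0_norm ?absv_ge0.
have [n _ /(_ n.+1)] := cvgr0_norm_lt _ w0 _ d0.
rewrite /= leqnSn -absvX -rmorphXn ger0_norm ?absv_ge0// => /(_ isT)/dP.
by rewrite normrX leNgt exprn_egt1.
Qed.

Lemma absv_real_le s t : `|s| <= `|t| -> absv (phi s) <= absv (phi t).
Proof.
have [->|s0] := eqVneq s 0; first by rewrite rmorph0 absv0 absv_ge0.
move=> st; have : 1 <= absv (phi (t / s)).
  by apply: absv_real_ge1; rewrite normf_div ler_pdivlMr ?normr_gt0// mul1r.
rewrite rmorphM fmorphV absvM absvV ler_pdivlMr ?absv_real_gt0//.
by rewrite mul1r.
Qed.

Lemma absv_real_lt_small (e : R) : 0 < e ->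
  exists2 t, 0 < t & absv (phi t) < e.
Proof.
move=> e0; have [d d0 dP] := phi_small (divr_gt0 e0 (@ltr0n R 2)).
exists (d / 2); first by rewrite divr_gt0.
apply: (@le_lt_trans _ _ (e / 2)); last by lra.
by apply: dP; rewrite gtr0_norm ?divr_gt0//; lra.
Qed.

Lemma absv_real_gt_big (M : R) : exists2 t, 0 < t & M < absv (phi t).
Proof.
have M0 : 0 < `|M| + 1 by rewrite ltr_wpDl.
have := absv_real_lt_small (_ : 0 < (`|M| + 1)^-1).
rewrite invr_gt0 => /(_ M0)[t t0 tM]; exists t^-1; first by rewrite invr_gt0.
apply: (@lt_trans _ _ (`|M| + 1)); first by have := ler_norm M; lra.
have wt0 : 0 < absv (phi t) by rewrite absv_real_gt0// gt_eqF.
by rewrite fmorphV absvV -[ltLHS]invrK ltf_pV2 ?posrE ?invr_gt0.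
Qed.

Section Element.
Variable x : D.

Lemma comm_phi : commr_rmorph phi x.
Proof. by move=> t; exact/esym/phi_central. Qed.

Local Notation ev := (horner_morph comm_phi).

(** For [c >= 0] these are the values at [x] of the real monic quadratic
    polynomials with conjugate roots [a +- i sqrt c]. *)
Definition quad (a c : R) : D := (x - phi a) ^+ 2 + phi c.

Lemma ev_quad a c : ev (('X - a%:P) ^+ 2 + c%:P) = quad a c.
Proof.
by rewrite rmorphD rmorphXn rmorphB/= horner_morphX !horner_morphC.
Qed.

(** A lower bound on quadratics with conjugate roots propagates to all monic
    polynomials, by [monic_sqr_prod] and multiplicativity of [absv]. *)
Lemma absv_monic_ge (m : R) : 0 <= m ->
  (forall a c, 0 <= c -> m <= absv (quad a c)) ->
  forall P : {poly R}, P \is monic -> m ^+ (size P).-1 <= absv (ev P) ^+ 2.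
Proof.
move=> m0 mP P /monic_sqr_prod[r <- PE].
rewrite -absvX -rmorphXn PE; elim: r {PE} => [|p r IH].
  by rewrite big_nil rmorph1 absv1.
rewrite big_cons rmorphM absvM/= exprS ler_pM ?exprn_ge0//.
by rewrite ev_quad mP ?sqr_ge0.
Qed.

Lemma quad_shift a c e : quad a (c + e) = quad a c + phi e.
Proof. by rewrite /quad rmorphD addrA. Qed.

(** Put [Q = ('X - a) ^+ 2 + c]. For every [n] the polynomial [Q + e] divides
    [Q ^+ n.+1 - (- e) ^+ n.+1], and the cofactor is monic of degree [2 n], so
    its value at [x] is at least [m ^+ n]. Hence the value of [Q + e] is at most
    [(m ^+ n.+1 + |e| ^+ n.+1) / m ^+ n], which tends to [m] when [|e| < m]. *)
Lemma quad_step (m a c e : R) : 0 < m ->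
  (forall a c, 0 <= c -> m <= absv (quad a c)) ->
  absv (quad a c) = m -> absv (phi e) < m -> absv (quad a (c + e)) <= m.
Proof.
move=> m0 mP qm em.
have bound n :
    absv (quad a (c + e)) <= m + absv (phi e) * (absv (phi e) / m) ^+ n.
  pose Q := ('X - a%:P) ^+ 2 + c%:P : {poly R}.
  pose g := Q + e%:P.
  pose H := \sum_(i < n.+1) Q ^+ (n - i) * (- e%:P) ^+ i.
  have GE : Q ^+ n.+1 - (- e%:P) ^+ n.+1 = g * H.
    by rewrite subrXX opprK.
  have evQ : ev Q = quad a c by rewrite ev_quad.
  have evg : ev g = quad a (c + e).
    by rewrite rmorphD/= evQ horner_morphC quad_shift.
  have size_sqr : size (('X - a%:P) ^+ 2 : {poly R}) = 3.
    by rewrite size_exp_XsubC.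
  have add_const (p : {poly R}) (t : R) : p \is monic -> (1 < size p)%N ->
      (p + t%:P \is monic) /\ size (p + t%:P) = size p.
    move=> pm p1; have tp : (size t%:P < size p)%N.
      by rewrite (leq_ltn_trans (size_polyC_leq1 _)).
    by rewrite monicE lead_coefDl// size_polyDl// (monicP pm) eqxx.
  have [Qm sQ] : Q \is monic /\ size Q = 3.
    rewrite -size_sqr; apply: add_const; last by rewrite size_sqr.
    by rewrite rpredX// monicXsubC.
  have [gm sg] : g \is monic /\ size g = 3.
    by rewrite -sQ; apply: add_const => //; rewrite sQ.
  have sQn : size (Q ^+ n.+1) = (2 * n.+1).+1.
    by rewrite -[LHS]prednK ?size_exp ?sQ// lt0n size_poly_eq0 monic_neq0//
      rpredX.
  have [Gm sG] : (g * H \is monic) /\ size (g * H) = (2 * n.+1).+1.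
    rewrite -sQn -GE -polyCN -rmorphXn -polyCN; apply: add_const.
      by rewrite rpredX.
    by rewrite sQn.
  have Hm : H \is monic by rewrite -(monicMl _ gm).
  have sH : (size H).-1 = (2 * n)%N.
    by move: sG; rewrite size_monicM ?monic_neq0// sg; lia.
  have mH : m ^+ n <= absv (ev H).
    rewrite -(@ler_pXn2r _ 2)// ?nnegrE ?absv_ge0 ?exprn_ge0 ?(ltW m0)//.
    by rewrite -exprM mulnC -sH; apply: absv_monic_ge => //; exact: ltW.
  have G_le : absv (ev (g * H)) <= m ^+ n.+1 + absv (phi e) ^+ n.+1.
    rewrite -GE rmorphB !rmorphXn rmorphN/= evQ horner_morphC.
    rewrite (le_trans (ler_absvD _ _))// absvN !absvX absvN qm.
    exact: lexx.
  have : absv (quad a (c + e)) * m ^+ n <= m ^+ n.+1 + absv (phi e) ^+ n.+1.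
    apply: le_trans G_le; rewrite rmorphM absvM/= evg.
    by rewrite ler_wpM2l ?absv_ge0.
  rewrite -ler_pdivlMr ?exprn_gt0// => /le_trans; apply.
  by rewrite mulrDl !exprS mulfK ?expf_neq0 ?gt_eqF// expr_div_n mulrA.
apply: (cvgr_to_ge (F := \oo)
  (f := fun n => m + absv (phi e) * (absv (phi e) / m) ^+ n)); last first.
  by near=> n; exact: bound.
rewrite -[X in _ --> X]addr0 -[in X in _ --> X](mulr0 (absv (phi e))).
apply: cvgD; first exact: cvg_cst.
apply: cvgM; first exact: cvg_cst.
apply: cvg_expr; rewrite ger0_norm ?divr_ge0 ?absv_ge0 ?(ltW m0)//.
by rewrite ltr_pdivrMr// mul1r.
Unshelve. all: by end_near. Qed.

Lemma quad_cvg (p : R * R) : quad q.1 q.2 @[q --> p] --> quad p.1 p.2.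
Proof.
have c1 : x - phi q.1 @[q --> p] --> x - phi p.1.
  apply: absv_cvgB; first exact: cvg_cst.
  by apply: (cvg_comp _ phi); [exact: cvg_fst|exact: phi_cvg].
apply: absv_cvgD; first by rewrite expr2; exact: absv_cvgM.
by apply: (cvg_comp _ phi); [exact: cvg_snd|exact: phi_cvg].
Qed.

(** Compactness: the modulus [t = sqrt (a ^+ 2 + c)] of the roots controls
    [quad a c], whose size is at least [|t| ^+ 2 - |2 a x| - |x ^+ 2|] with
    [|a| <= |t|]. So the values outside a large box exceed the one at [(0, 0)],
    and the minimum over the box is global. *)
Lemma quad_min : exists a0 c0, 0 <= c0 /\
  forall a c, 0 <= c -> absv (quad a0 c0) <= absv (quad a c).
Proof.
pose N := absv x ^+ 2; pose B := absv (phi 2) * absv x.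
have [N0 B0] : 0 <= N /\ 0 <= B by rewrite exprn_ge0 ?mulr_ge0 ?absv_ge0.
have [T T0 TB] := absv_real_gt_big (B + 2 * N + 1).
pose K : set (R * R) := `[- T, T] `*` `[0, T ^+ 2].
have K00 : K (0, 0).
  by split; rewrite /= in_itv/= ?lexx ?sqr_ge0//; apply/andP; split; lra.
have [] := @compact_EVT_min _ R (fun p => absv (quad p.1 p.2)) K.
- by exists (0, 0).
- by apply: compact_setX; exact: segment_compact.
- by apply: continuous_subspaceT => p; apply: absv_cvg; exact: quad_cvg.
move=> [a0 c0] /set_mem[_ /= c0K] min0; exists a0, c0; split.
  by move: c0K; rewrite in_itv/= => /andP[].
move=> a c c_ge0; have [acK|acK] := pselect (K (a, c)).
  by apply: (min0 (a, c)); exact/mem_set.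
apply: (@le_trans _ _ N).
  have := min0 (0, 0) (mem_set K00); rewrite /= /quad !rmorph0 subr0 addr0.
  by rewrite absvX.
pose t := Num.sqrt (a ^+ 2 + c).
have t2 : t ^+ 2 = a ^+ 2 + c by rewrite sqr_sqrtr// addr_ge0// sqr_ge0.
have t_ge0 : 0 <= t by exact: sqrtr_ge0.
have at_ : `|a| <= t.
  by rewrite -ler_sqr ?nnegrE// t2 real_normK ?num_real// lerDl.
have Tt : T <= t.
  rewrite leNgt; apply/negP => tT; apply: acK.
  have tT2 : t ^+ 2 < T ^+ 2 by rewrite ltr_sqr ?nnegrE// ltW.
  split; rewrite /= in_itv/=.
    by rewrite -ler_norml (le_trans at_)// ltW.
  by rewrite c_ge0/= (le_trans _ (ltW tT2))// t2 lerDr sqr_ge0.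
have wt : B + 2 * N + 1 <= absv (phi t).
  by rewrite (le_trans (ltW TB))// absv_real_le// !ger0_norm// ltW.
have wa : absv (phi a) <= absv (phi t).
  by rewrite absv_real_le// (le_trans at_)// ger0_norm.
have quadE : quad a c = phi t ^+ 2 - (phi 2 * phi a * x - x ^+ 2).
  have pE : ('X - a%:P) ^+ 2 + c%:P =
      (t ^+ 2)%:P - ((2 * a)%:P * 'X - 'X ^+ 2) :> {poly R}.
    by rewrite t2 !(rmorphD, rmorphM, rmorphXn, rmorph_nat)/=; ring.
  rewrite -ev_quad pE !(rmorphB, rmorphM, rmorphXn)/= horner_morphX.
  by rewrite !horner_morphC.
have : absv (phi t) ^+ 2 - (absv (phi 2) * absv (phi a) * absv x + N)
    <= absv (quad a c).
  rewrite quadE (le_trans _ (ler_absv_sub _ _))// absvX lerB//.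
  by rewrite (le_trans (ler_absvD _ _))// absvN absvX !absvM.
apply: le_trans.
have : absv (phi 2) * absv (phi a) * absv x <= B * absv (phi t).
  by rewrite mulrAC ler_wpM2l.
nra.
Qed.

(** If the minimum [m] were positive, [quad_step] would allow adding a fixed
    small [e > 0] to [c] again and again without leaving the value [m], although
    [phi (e *+ k)] is unbounded in [k]. *)
Lemma quad_root : exists a c, 0 <= c /\ quad a c = 0.
Proof.
have [a [c [c0 min]]] := quad_min; exists a, c; split => //.
apply/absv_eq0; apply: contrapT => /eqP mn0.
set m := absv (quad a c) in min mn0.
have m0 : 0 < m by rewrite lt_neqAle eq_sym mn0 absv_ge0.
have [e e0 em] := absv_real_lt_small m0.
have stay k : absv (quad a (c + e *+ k)) = m.
  elim: k => [|k IH]; first by rewrite mulr0n addr0.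
  apply/eqP; rewrite eq_le min ?addr_ge0 ?mulrn_wge0 ?(ltW e0)// andbT.
  by rewrite mulrSr addrA quad_step.
have [T T0 mT] := absv_real_gt_big (m + m).
have [k Tk] : exists k : nat, T <= e *+ k.
  exists (Num.truncn (T / e)).+1.
  by rewrite -mulr_natr mulrC -ler_pdivrMr// ltW// truncnS_gt.
have : absv (phi (e *+ k)) <= m + m.
  have -> : phi (e *+ k) = quad a (c + e *+ k) - quad a c.
    by rewrite quad_shift addrAC subrr add0r.
  by rewrite (le_trans (ler_absvD _ _))// absvN stay.
apply/negP; rewrite -ltNge (lt_le_trans mT)// absv_real_le//.
by rewrite !ger0_norm ?mulrn_wge0// ltW.
Qed.

End Element.
End Ostrowski.

(** * Continuity of center-linear maps *)

Section Averaging.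
Context {A : pzRingType}.
Implicit Types (i j x : A).

(** When [i * i = -1], conjugation by [i] is an involution and [average i x] is
    twice the projection of [x] onto its fixed points. *)
Definition average i x : A := x - i * x * i.

Lemma average_comm i x : i * i = -1 -> GRing.comm i (average i x).
Proof.
move=> ii; rewrite /GRing.comm /average mulrBr mulrBl !mulrA ii mulN1r.
by rewrite -[i * x * i * i]mulrA ii mulrN1 mulNr !opprK addrC.
Qed.

Lemma average_comm_anti i j x : i * j = - (j * i) -> GRing.comm i x ->
  GRing.comm i (average j x).
Proof.
move=> ij ix; rewrite /GRing.comm /average mulrBr mulrBl; congr (_ - _) => //.
rewrite !mulrA ij !mulNr -(mulrA j i x) ix mulrA.
by rewrite -[_ * i * j]mulrA ij mulrN opprK !mulrA.
Qed.

(** The part of [x] that anticommutes with [i] is brought back into the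
    centralizer of [i] by the multiplication by [j]. *)
Lemma average_split i j x : i * j = - (j * i) -> j * j = -1 ->
  x + x = average i x - j * average i (j * x).
Proof.
move=> ij jj; have ji : j * i = - (i * j) by rewrite ij opprK.
rewrite /average mulrBr !mulrA jj ji mulN1r !mulNr -[i * j * j]mulrA jj.
by rewrite mulrN1 !mulNr opprK opprB opprK addrA subrK.
Qed.

Lemma diff_sqr0 x i j : i * i = x -> j * j = x -> GRing.comm i j ->
  (i - j) * (i + j) = 0.
Proof.
by move=> ii jj ij; rewrite mulrBl !mulrDr ii jj ij [X in _ - X]addrC subrr.
Qed.

End Averaging.

Section CenterLinear.
Local Open Scope classical_set_scope.
Context {R : realType} {D : absValuedDivRingType R} (phi : {rmorphism R -> D}).
Hypothesis phi_central : forall t, central (phi t).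
Hypothesis quadratic :
  forall x, exists a b, (x - phi a) ^+ 2 = - (phi b ^+ 2).
Implicit Types (i j x y z : D).

Lemma divring_double_eq0 x : x + x = 0 -> x = 0.
Proof.
rewrite -mulr2n -mulr_natl -(rmorph_nat phi) => /divring_mulf_eq0[|//].
by move/eqP; rewrite fmorph_eq0 pnatr_eq0.
Qed.

(** In the commutative subring generated by [i] and [z], the quadratic equation
    of [z] already has its two roots in the span of 1 and [i]. *)
Lemma comm_complex i z : i * i = -1 -> GRing.comm i z ->
  exists a b, z = phi a + phi b * i.
Proof.
move=> ii iz; have [a [b zab]] := quadratic z.
pose u := z - phi a; pose v := phi b * i.
have uv : u * v = v * u.
  have iu : GRing.comm i u by apply: commrB => //; exact/esym/phi_central.
  by rewrite /v mulrA -[u * _]phi_central -!mulrA iu.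
have uu : u * u = - (phi b ^+ 2) by rewrite -expr2.
have vv : v * v = - (phi b ^+ 2).
  rewrite /v mulrA -[phi b * i * phi b]phi_central mulrA -mulrA ii mulrN1.
  by rewrite expr2.
have : (u - v) * (u + v) = 0.
  exact: diff_sqr0 uu vv uv.
case/divring_mulf_eq0 => /eqP.
  by rewrite subr_eq0 => /eqP uE; exists a, b; rewrite -/v -uE addrC subrK.
rewrite addr_eq0 => /eqP uE; exists a, (- b).
by rewrite rmorphN mulNr -/v -uE addrC subrK.
Qed.

Lemma comm_quaternion_central i j z :
  i * i = -1 -> j * j = -1 -> i * j = - (j * i) ->
  GRing.comm i z -> GRing.comm j z -> central z.
Proof.
move=> ii jj ij iz jz; have [a [b zE]] := comm_complex ii iz.
have b0 : phi b * (i * j) = 0.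
  apply: divring_double_eq0; apply/eqP; rewrite addr_eq0; apply/eqP.
  have : GRing.comm j (phi b * i).
    have -> : phi b * i = z - phi a by rewrite zE addrC addKr.
    by apply: commrB => //; exact/esym/phi_central.
  rewrite /GRing.comm -[RHS]mulrA => e; rewrite -{1}e.
  by rewrite mulrA -[j * _]phi_central ij mulrN opprK mulrA.
have j0 : j != 0.
  by apply/eqP => j0; move/eqP: jj; rewrite j0 mul0r eq_sym oppr_eq0 oner_eq0.
rewrite zE; move: b0; rewrite mulrA => /divring_mulf_eq0[->|/eqP].
  by rewrite addr0; exact: phi_central.
by rewrite (negbTE j0).
Qed.

Lemma sqr_normalize u b : b != 0 -> u * u = - (phi b ^+ 2) ->
  (phi b^-1 * u) * (phi b^-1 * u) = -1.
Proof.
move=> b0 uu; rewrite mulrA -(mulrA _ u) -[u * _]phi_central.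
rewrite mulrA -rmorphM -mulrA uu mulrN -rmorphXn -rmorphM.
by rewrite -expr2 exprVn mulVf ?expf_neq0// rmorph1.
Qed.

(** Frobenius' construction: [i] is the normalized imaginary part of [x], and
    [k = y + i * y * i], which anticommutes with [i], has a real square; this
    square is negative, since otherwise [k] would be real. *)
Lemma quaternion_units x y : x * y <> y * x -> exists i j,
  [/\ i * i = -1, j * j = -1 & i * j = - (j * i)].
Proof.
move=> xy; have [a [b xab]] := quadratic x.
pose u := x - phi a.
have xE : x = u + phi a by rewrite subrK.
have b0 : b != 0.
  apply/eqP => b0; move: xab; rewrite b0 rmorph0 expr0n oppr0 expr2 -/u.
  case/divring_mulf_eq0 => u0; apply: xy;
    by rewrite xE u0 add0r phi_central.
have [i ii uE] : exists2 i, i * i = -1 & u = phi b * i.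
  exists (phi b^-1 * u); first by apply: sqr_normalize => //; rewrite -expr2.
  by rewrite mulrA -rmorphM mulfV// rmorph1 mul1r.
have iy : i * y <> y * i.
  move=> iy; apply: xy; rewrite xE mulrDl mulrDr phi_central; congr (_ + _).
  by rewrite uE -mulrA iy mulrA phi_central mulrA.
have [k ik k0] : exists2 k, i * k = - (k * i) & k <> 0.
  exists (y + i * y * i).
    rewrite mulrDr mulrDl !mulrA ii -[i * y * i * i]mulrA ii.
    by rewrite mulN1r mulNr mulrN1 opprB.
  move=> k0; apply: iy; have /eqP : i * (y + i * y * i) = 0.
    by rewrite k0 mulr0.
  by rewrite mulrDr !mulrA ii mulN1r mulNr subr_eq0 => /eqP.
have i0 : i <> 0.
  by move=> i0; move/eqP: ii; rewrite i0 mul0r eq_sym oppr_eq0 oner_eq0.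
have real0 (z : D) : z * i = - (i * z) -> i * z = z * i -> z = 0.
  move=> zi; rewrite zi => /eqP; rewrite -addr_eq0 => /eqP/divring_double_eq0.
  by case/divring_mulf_eq0.
(* [k * k] commutes with [i], hence lies in the span of 1 and [i]; commuting
   with [k] as well, it has no component along [i] *)
have [c [d kkE]] : exists c d, k * k = phi c + phi d * i.
  apply: comm_complex => //.
  by rewrite /GRing.comm mulrA ik mulNr -mulrA ik mulrN opprK mulrA.
have kk : k * k = phi c.
  suff d0 : phi d = 0 by rewrite kkE d0 mul0r addr0.
  have : (phi d * i) * k = 0.
    apply: divring_double_eq0; apply/eqP; rewrite addr_eq0; apply/eqP.
    have wk : phi d * i * k = k * (phi d * i).
      have -> : phi d * i = k * k - phi c by rewrite kkE addrC addKr.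
      by rewrite mulrBl mulrBr -mulrA phi_central.
    by rewrite {1}wk mulrA -[k * _]phi_central -!mulrA ik mulrN opprK.
  by case/divring_mulf_eq0 => // /divring_mulf_eq0[].
have nonreal t : k <> phi t.
  move=> kt; apply: k0; apply: real0; first by rewrite ik opprK.
  by rewrite kt -phi_central.
have [c_ge0|c_lt0] := leP 0 c.
  have cc : phi (Num.sqrt c) * phi (Num.sqrt c) = phi c.
    by rewrite -rmorphM -expr2 sqr_sqrtr.
  have := diff_sqr0 kk cc (esym (phi_central _ _)).
  case/divring_mulf_eq0 => /eqP; first by rewrite subr_eq0 => /eqP/nonreal.
  by rewrite addr_eq0 -rmorphN => /eqP/nonreal.
exists i, (phi (Num.sqrt (- c))^-1 * k); split=> //.
  apply: sqr_normalize; first by rewrite gt_eqF// sqrtr_gt0 oppr_gt0.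
  by rewrite kk -rmorphXn sqr_sqrtr ?oppr_ge0 ?ltW// rmorphN opprK.
by rewrite mulrA -[i * phi _]phi_central -!mulrA ik mulrN.
Qed.

Lemma average_cvg i (f : D -> D) x : f y @[y --> x] --> f x ->
  average i (f y) @[y --> x] --> average i (f x).
Proof.
move=> fx; apply: (absv_cvgB fx (g := fun y => i * f y * i)).
exact: absv_cvgM (absv_cvgM (cvg_cst i) fx) (cvg_cst i).
Qed.

(** Up to the factor 4, the components [z1 y], [z2 y], ... of [y] along
    quaternion units, obtained by averaging over [i] and then over [j]. They are
    given by polynomial expressions in [y], hence are continuous. *)
Lemma quaternion_coordinates : ~ (forall x y : D, x * y = y * x) ->
  exists i j (z1 z2 : D -> D),
    [/\ forall y, central (z1 y), forall y, central (z2 y),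
        continuous z1, continuous z2 &
        forall y, (y + y) + (y + y) =
          z1 y - z2 y * i - (z1 (j * y) * j - z2 (j * y) * (j * i))].
Proof.
move=> /existsNP[x0 /existsNP[y0 /quaternion_units[i [j [ii jj ij]]]]].
have av_i y : GRing.comm i (average i y) by exact: average_comm.
have av_cvg x : average i y @[y --> x] --> average i x.
  exact: (average_cvg (f := fun y => y) cvg_id).
have central_ij y : GRing.comm i y -> central (average j y).
  move=> iy; apply: (comm_quaternion_central ii jj ij).
    exact: average_comm_anti.
  exact: average_comm.
exists i, j, (fun y => average j (average i y)),
  (fun y => average j (i * average i y)); split.
- by move=> y; exact: central_ij.
- by move=> y; apply: central_ij; exact: commrM.
- by move=> x; exact: (average_cvg (f := average i) (av_cvg x)).
- move=> x; apply: (average_cvg (f := fun y => i * average i y)).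
  exact: (absv_cvgMl (f := average i) (av_cvg x)).
- have av2 y : average i y + average i y =
      average j (average i y) - average j (i * average i y) * i.
    rewrite central_ij; last exact: commrM.
    by apply: average_split; rewrite // ij opprK.
  move=> y; rewrite [in LHS](average_split y ij jj) addrACA -opprD -mulrDr !av2.
  have z1C : j * average j (average i (j * y)) =
      average j (average i (j * y)) * j by rewrite central_ij.
  have z2C : j * average j (i * average i (j * y)) =
      average j (i * average i (j * y)) * j.
    by rewrite central_ij//; exact: commrM.
  by rewrite [j * (_ - _)]mulrBr mulrA z1C z2C -mulrA.
Qed.

Lemma center_linear_continuous (L : D -> D) : center_linear L -> continuous L.
Proof.
move=> [LD LZ]; suff : forall x : D, L y @[y --> x] --> L x by [].
move=> x; have id_cvg : y @[y --> x] --> x by exact: cvg_id.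
have [comm|] := pselect (forall x y : D, x * y = y * x).
  have -> : L = fun y => y * L 1.
    by apply/funext => y; rewrite -LZ ?mulr1// => z; exact: comm.
  exact: (absv_cvgMr id_cvg).
move=> /quaternion_coordinates[i [j [z1 [z2 [z1C z2C z1_cvg z2_cvg yE]]]]].
have LB u v : L (u - v) = L u - L v.
  by rewrite -[u in RHS](subrK v) (LD (u - v) v) addrK.
have LE y : L y = phi 4^-1 * (z1 y * L 1 - z2 y * L i -
    (z1 (j * y) * L j - z2 (j * y) * L (j * i))).
  rewrite -!LZ// -!LB mulr1 -yE -LZ//.
  have -> : y + y + (y + y) = phi 4 * y.
    by rewrite rmorph_nat mulr_natl -!mulr2n -mulrnA.
  by rewrite mulrA -rmorphM mulVf ?pnatr_eq0// rmorph1 mul1r.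
have j_cvg : j * y @[y --> x] --> j * x.
  exact: (absv_cvgMl id_cvg).
have z1j : z1 (j * y) @[y --> x] --> z1 (j * x).
  exact: (cvg_comp _ z1 j_cvg (z1_cvg _)).
have z2j : z2 (j * y) @[y --> x] --> z2 (j * x).
  exact: (cvg_comp _ z2 j_cvg (z2_cvg _)).
suff : phi 4^-1 * (z1 y * L 1 - z2 y * L i -
    (z1 (j * y) * L j - z2 (j * y) * L (j * i))) @[y --> x] --> L x.
  by rewrite -(funext LE).
rewrite (LE x).
exact (absv_cvgMl (absv_cvgB
  (absv_cvgB (absv_cvgMr (z1_cvg x)) (absv_cvgMr (z2_cvg x)))
  (absv_cvgB (absv_cvgMr z1j) (absv_cvgMr z2j)))).
Qed.

End CenterLinear.

(** * Differential calculus and the Leibniz formula *)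

Section Calculus.
Local Open Scope classical_set_scope.
Context {R : realType} {D : absValuedDivRingType R}.
Hypothesis D_complete : complete_char0 D.
Implicit Types (f g L o : D -> D) (x a c h : D) (hs : seq D).

Lemma complete_center_linear_continuous L : center_linear L -> continuous L.
Proof.
have [phi [phiC phi_small phi_bounded]] := real_embedding D_complete.
apply: (center_linear_continuous phiC) => x.
have [a [c [c0]]] := quad_root phiC phi_small phi_bounded x.
rewrite /quad => /eqP; rewrite addr_eq0 => /eqP xac.
by exists a, (Num.sqrt c); rewrite xac -rmorphXn sqr_sqrtr.
Qed.

Lemma central_small (e : R) : 0 < e ->
  exists z : D, [/\ central z, z != 0 & absv z < e].
Proof.
move=> e0; have [phi [phiC phi_small _]] := real_embedding D_complete.
have [t t0 te] := absv_real_lt_small phi_small e0.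
by exists (phi t); rewrite fmorph_eq0 gt_eqF.
Qed.

Lemma center_linear0 L : center_linear L -> L 0 = 0.
Proof. by move=> [LD _]; apply: (addrI (L 0)); rewrite -LD !addr0. Qed.

(** On a line spanned by central elements the difference of two derivatives is
    homogeneous, so it cannot be negligible at 0 unless it vanishes; central
    elements arbitrarily close to 0 come from the copy of the reals. *)
Lemma gateaux_derivative_unique f x L1 L2 :
  is_gateaux_derivative f x L1 -> is_gateaux_derivative f x L2 -> L1 = L2.
Proof.
move=> [L1l [r1 [r1E _ r1P]]] [L2l [r2 [r2E _ r2P]]]; apply/funext => a.
have [->|a0] := eqVneq a 0; first by rewrite !center_linear0.
apply: contrapT => La; pose e := absv (L1 a - L2 a) / absv a.
have e0 : 0 < e.
  by rewrite divr_gt0// absv_gt0// subr_eq0; apply/eqP.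
have r12 : absv (r1 b) / absv b + absv (r2 b) / absv b @[b --> 0^'] --> (0 : R).
  by rewrite -[X in _ --> X]addr0; exact: cvgD.
have /nbhs_ballP[d /= d0 dP] : nbhs (0 : D) (fun b => b != 0 ->
    `|absv (r1 b) / absv b + absv (r2 b) / absv b| < e).
  exact: (cvgr0_norm_lt _ r12 _ e0).
have [z [zC z0 zd]] : exists z : D, [/\ central z, z != 0 & absv z < d / absv a].
  by apply: central_small; rewrite divr_gt0// absv_gt0.
have : ball (0 : D) d (z * a).
  by rewrite /ball/= /absv_dist sub0r absvN absvM -ltr_pdivlMr ?absv_gt0//.
have za0 : z * a != 0 by apply/eqP => /divring_mulf_eq0[]; exact/eqP.
move=> /dP/(_ za0) /=; apply/negP; rewrite -leNgt ger0_norm; last first.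
  by rewrite addr_ge0// divr_ge0// absv_ge0.
rewrite -mulrDl /e ler_pdivlMr ?absv_gt0//.
have -> : absv (L1 a - L2 a) / absv a * absv (z * a) =
    absv (L1 (z * a) - L2 (z * a)).
  case: L1l L2l => _ L1Z [_ L2Z].
  by rewrite L1Z// L2Z// -mulrBr !absvM mulrCA divfK ?gt_eqF ?absv_gt0// mulrC.
have -> : L1 (z * a) - L2 (z * a) = r2 (z * a) - r1 (z * a).
  apply/eqP; rewrite subr_eq addrAC eq_sym subr_eq -r1E.
  by rewrite addrC -r2E.
by rewrite (le_trans (ler_absvD _ _))// absvN addrC.
Qed.

Lemma gateauxE f x L : is_gateaux_derivative f x L -> gateaux f x = L.
Proof.
move=> fL; apply: xget_unique => // L' fL'.
exact: gateaux_derivative_unique fL' fL.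
Qed.

Lemma gateauxP f x :
  gateaux_differentiable f -> is_gateaux_derivative f x (gateaux f x).
Proof. by move=> /(_ x) fx; exact: (xgetPex _ fx). Qed.

Lemma is_gateaux_derivative0 x :
  is_gateaux_derivative (fun=> 0 : D) x (fun=> 0).
Proof.
split; first by split=> [a b|z a _]; rewrite ?addr0 ?mulr0.
exists (fun=> 0); split=> [a||]; first by rewrite subrr addr0.
  exact: cst_continuous.
by rewrite absv0; under eq_fun do rewrite mul0r; exact: cvg_cst.
Qed.

Lemma is_gateaux_derivativeD f g x L1 L2 :
  is_gateaux_derivative f x L1 -> is_gateaux_derivative g x L2 ->
  is_gateaux_derivative (fun y => f y + g y) x (fun a => L1 a + L2 a).
Proof.
move=> [[L1D L1Z] [r1 [r1E r1c r1P]]] [[L2D L2Z] [r2 [r2E r2c r2P]]].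
split.
  split=> [a b|z a zC]; first by rewrite L1D L2D addrACA.
  by rewrite L1Z// L2Z// mulrDr.
exists (fun a => r1 a + r2 a); split=> [a||].
- by rewrite opprD addrACA r1E r2E addrACA.
- by move=> a; exact: absv_cvgD (r1c a) (r2c a).
- apply: (squeeze_cvgr (f := fun=> 0)
    (h := fun a => absv (r1 a) / absv a + absv (r2 a) / absv a)).
  + near=> a; rewrite divr_ge0 ?absv_ge0//= -mulrDl.
    by rewrite ler_wpM2r ?invr_ge0 ?absv_ge0 ?ler_absvD.
  + exact: cvg_cst.
  + by rewrite -[X in _ --> X]addr0; exact: cvgD.
Unshelve. all: by end_near. Qed.

Lemma is_gateaux_derivativeMr f x L c : is_gateaux_derivative f x L ->
  is_gateaux_derivative (fun y => f y * c) x (fun a => L a * c).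
Proof.
move=> [[LD LZ] [r [rE rc rP]]]; split.
  split=> [a b|z a zC]; first by rewrite LD mulrDl.
  by rewrite LZ// mulrA.
exists (fun a => r a * c); split=> [a||].
- by rewrite -mulrBl rE mulrDl.
- by move=> a; exact: absv_cvgMr (rc a).
- under eq_fun do rewrite absvM mulrAC.
  by rewrite -(mul0r (absv c)); apply: cvgM => //; exact: cvg_cst.
Qed.

Lemma is_gateaux_derivative_sum (I : Type) (r : seq I) (F L : I -> D -> D) x :
  (forall i, is_gateaux_derivative (F i) x (L i)) ->
  is_gateaux_derivative (fun y => \sum_(i <- r) F i y) x
    (fun a => \sum_(i <- r) L i a).
Proof.
move=> FL; elim: r => [|i r IH].
  under eq_fun do rewrite big_nil; under [X in _ _ X]eq_fun do rewrite big_nil.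
  exact: is_gateaux_derivative0.
under eq_fun do rewrite big_cons; under [X in _ _ X]eq_fun do rewrite big_cons.
exact: is_gateaux_derivativeD.
Qed.

(** The only rule that needs the continuity of [L], both for the continuity of
    the remainder [L a * a + o a * (x + a)] and, through [L a --> 0], for its
    negligibility. *)
Lemma is_gateaux_derivative_mul_id g x L : is_gateaux_derivative g x L ->
  is_gateaux_derivative (fun y => g y * y) x (fun a => L a * x + g x * a).
Proof.
move=> [Ll [r [rE rc rP]]]; have [LD LZ] := Ll.
have Lc := complete_center_linear_continuous Ll.
split.
  split=> [a b|z a zC]; first by rewrite LD mulrDl mulrDr addrACA.
  by rewrite LZ// mulrDr !mulrA -(zC (g x)).
have id_cvg (a : D) : y @[y --> a] --> a by exact: cvg_id.
have shift_cvg (a : D) : x + b @[b --> a] --> x + a.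
  exact (absv_cvgD (cvg_cst x) (id_cvg a)).
exists (fun a => L a * a + r a * (x + a)); split=> [a||].
- have -> : g (x + a) = g x + (L a + r a) by rewrite -rE [g x + _]addrC subrK.
  rewrite mulrDl [g x * _]mulrDr [(L a + r a) * _]mulrDl.
  rewrite [L a * (x + a)]mulrDr -[g x * x + _ + _]addrA [g x * x + _]addrC.
  by rewrite addrK -(addrA (L a * x)) addrCA addrA.
- move=> a; exact (absv_cvgD (absv_cvgM (Lc a) (id_cvg a))
    (absv_cvgM (rc a) (shift_cvg a))).
- apply: (squeeze_cvgr (f := fun=> 0)
    (h := fun a => absv (L a) + absv (r a) / absv a * absv (x + a))).
  + near=> a; rewrite divr_ge0 ?absv_ge0//=.
    have a0 : 0 < absv a by rewrite absv_gt0; near: a; exact: nbhs_dnbhs_neq.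
    rewrite ler_pdivrMr// mulrDl [_ / _ * _ * _]mulrAC divfK ?gt_eqF//.
    by rewrite -!absvM ler_absvD.
  + exact: cvg_cst.
  + have -> : 0 = absv (L 0) + 0 * absv (x + 0) :> R.
      by rewrite mul0r addr0 center_linear0// absv0.
    apply: cvgD; first by apply: cvg_within_filter; exact: absv_cvg (Lc 0).
    apply: cvgM => //.
    by apply: cvg_within_filter; exact: absv_cvg (shift_cvg 0).
Unshelve. all: by end_near. Qed.

Definition leibniz f hs x : D := gateauxn f hs x * x +
  \sum_(i < size hs) gateauxn f (take i hs ++ drop i.+1 hs) x * hs`_i.

(** The term [gateauxn f hs x * a] produced by differentiating the factor [x] is
    the summand of [leibniz f (rcons hs a)] that omits the last direction. *)
Lemma is_gateaux_derivative_leibniz m f hs x :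
  gateaux_differentiable_upto m f -> (size hs < m)%N ->
  is_gateaux_derivative (leibniz f hs) x (fun a => leibniz f (rcons hs a) x).
Proof.
move=> f_diff hsm.
have dE : is_gateaux_derivative (leibniz f hs) x
    (fun a => (gateaux (gateauxn f hs) x a * x + gateauxn f hs x * a) +
      \sum_(i < size hs)
        gateaux (gateauxn f (take i hs ++ drop i.+1 hs)) x a * hs`_i).
  apply: is_gateaux_derivativeD.
    by apply: is_gateaux_derivative_mul_id; apply: gateauxP; exact: f_diff.
  apply: is_gateaux_derivative_sum => i.
  apply: is_gateaux_derivativeMr; apply: gateauxP; apply: f_diff.
  apply: leq_ltn_trans hsm.
  by rewrite size_cat size_takel 1?ltnW// size_drop; have := ltn_ord i; lia.
congr is_gateaux_derivative: dE; apply/funext => a.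
rewrite /leibniz gateauxn_rcons size_rcons big_ord_recr/= -addrA; congr (_ + _).
rewrite addrC; congr (_ + _).
  apply: eq_bigr => i _; rewrite nth_rcons ltn_ord; congr (_ * _).
  rewrite drop_rcons// -cats1 takel_cat 1?ltnW// -rcons_cat.
  by rewrite gateauxn_rcons.
rewrite nth_rcons ltnn eqxx; congr (_ * _).
by rewrite drop_oversize ?size_rcons// cats0 -cats1 take_size_cat.
Qed.

Lemma gateauxn_mul_id m f hs :
  gateaux_differentiable_upto m f -> (size hs <= m)%N ->
  gateauxn (fun y => f y * y) hs = leibniz f hs.
Proof.
move=> f_diff; elim/last_ind: hs => [_|hs h IH].
  by apply/funext => x; rewrite /leibniz big_ord0 addr0.
rewrite size_rcons => hsm; apply/funext => x.
rewrite gateauxn_rcons IH 1?ltnW//.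
by rewrite (gateauxE (is_gateaux_derivative_leibniz x f_diff hsm)).
Qed.

End Calculus.

Theorem theorem9p1 (R : realType) (D : absValuedDivRingType R)
    (D_complete : complete_char0 D) (m : nat) (m_gt0 : (0 < m)%N) (f : D -> D)
    (f_diff : gateaux_differentiable_upto m f) :
  gateaux_differentiable_upto m (fun x : D => f x * x) /\
  forall (x : D) (h : m.-tuple D),
    gateauxn (fun y : D => f y * y) h x =
      gateauxn f h x * x
      + \sum_(i < m) gateauxn f (take i h ++ drop i.+1 h) x * tnth h i.
Proof.
split=> [hs hsm x|x h].
  rewrite (gateauxn_mul_id D_complete f_diff (ltnW hsm)).
  by exists (fun a => leibniz f (rcons hs a) x);
    exact: is_gateaux_derivative_leibniz f_diff hsm.
rewrite (gateauxn_mul_id D_complete f_diff) ?size_tuple// /leibniz; congr (_ + _).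
rewrite size_tuple; apply: eq_bigr => i _.
by rewrite (tnth_nth 0).
Qed.
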